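(* There exist absolute constants $0 < c \le C$ such that for every integer $n \ge 2$ and every axis-aligned cube $\mathcal{C} \subseteq \mathbb{R}^n$ (that is, $\mathcal{C} = \prod_{i=1}^n [a_i, a_i + h]$ with $a \in \mathbb{R}^n$, $h > 0$), $$c\, n^{-1/2} \le \psi_{\mathcal{C}} \le C\, n^{-1/2}.$$
   Context: ''Measurable'' means Borel measurable and $\mathrm{vol}$ is $n$-dimensional Lebesgue measure. For $x \in \mathbb{R}^n$, $\ell_0(x) = \#\{i \in \{1,\dots,n\} : x_i \ne 0\}$. Two sets $A, B \subseteq \mathbb{R}^n$ are axis-disjoint if $\ell_0(x-y) \ge 2$ for all $x \in A$, $y \in B$. For a measurable $K \subseteq \mathbb{R}^n$ with $\mathrm{vol}(K) > 0$, the $\ell_0$-isoperimetric coefficient of $K$ is $$\psi_K := \inf \frac{\mathrm{vol}(K \setminus (S_1 \cup S_2))}{\min\{\mathrm{vol}(S_1), \mathrm{vol}(S_2)\}},$$ the infimum being over all pairs of axis-disjoint measurable sets $S_1, S_2 \subseteq K$ with $\min\{\mathrm{vol}(S_1),\mathrm{vol}(S_2)\} > 0$. *)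

(* Defs.v *)
From mathcomp Require Import all_boot all_order all_algebra.
From mathcomp Require Import all_classical all_reals all_analysis.
From mathcomp Require Import measurable_realfun.

Set Implicit Arguments.
Unset Strict Implicit.
Unset Printing Implicit Defensive.

Import Order.TTheory GRing.Theory Num.Theory.
Import numFieldNormedType.Exports.

Local Open Scope classical_set_scope.
Local Open Scope ring_scope.

Definition borel (R : realType) (n : nat) : set (set 'rV[R]_n) :=
  <<s @open 'rV[R]_n >>.

(* The library has no Lebesgue measure on R^n. On Borel sets it is the n-fold
   product of the one-dimensional one: the mass at the unique point of R^0,
   then, coordinate by coordinate, the integral of the measures of the slices
   [set y | (x, y) \in A] (volume_box below gives its value on boxes). *)
Fixpoint volume (R : realType) (n : nat) : set 'rV[R]_n -> \bar R :=
  match n return set 'rV[R]_n -> \bar R with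
  | 0 => fun A => (\1_A (0 : 'rV[R]_0))%:E
  | m.+1 => fun A => (\int[@lebesgue_measure R]_x
      volume [set y : 'rV[R]_m | A (row_mx (const_mx x : 'rV[R]_1) y)])%E
  end.

Definition l0 (R : realType) (n : nat) (x : 'rV[R]_n) : nat :=
  #|[pred i : 'I_n | x ord0 i != 0]|.

Definition axis_disjoint (R : realType) (n : nat) (A B : set 'rV[R]_n) : Prop :=
  forall x y, A x -> B y -> (2 <= l0 (x - y))%N.

(* Meant for Borel K of positive volume. Conventions of \bar R: the infimum of the
   empty family is +oo, and x / +oo = 0. *)
Definition psi (R : realType) (n : nat) (K : set 'rV[R]_n) : \bar R :=
  ereal_inf [set r : \bar R | exists S1 S2 : set 'rV[R]_n,
    [/\ borel S1 /\ borel S2,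
        S1 `<=` K /\ S2 `<=` K,
        axis_disjoint S1 S2,
        (0 < Order.min (volume S1) (volume S2))%E &
        r = (volume (K `\` (S1 `|` S2))
             / Order.min (volume S1) (volume S2))%E]].

Definition cube (R : realType) (n : nat) (a : 'rV[R]_n) (h : R)
  : set 'rV[R]_n :=
  [set x | forall i, a ord0 i <= x ord0 i <= a ord0 i + h].

Lemma volume_box (R : realType) (n : nat) (a b : 'rV[R]_n) :
  (forall i, a ord0 i <= b ord0 i) ->
  volume [set x | forall i, a ord0 i <= x ord0 i <= b ord0 i]
  = (\prod_(i < n) (b ord0 i - a ord0 i))%:E.
Proof.
elim: n a b => [|n IH] a b ab /=.
  by rewrite big_ord0 indicE mem_set// => -[].
have E (x : R) : volume [set y : 'rV[R]_n | forall i : 'I_(1 + n),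
     a ord0 i <= (row_mx (const_mx x : 'rV[R]_1) y) ord0 i <= b ord0 i] =
   ((\prod_(i < n) (b ord0 (lift ord0 i) - a ord0 (lift ord0 i)))%:E *
   (\1_(`[a ord0 ord0, b ord0 ord0]%classic) x)%:E)%E.
  have x0 (y : 'rV[R]_n) : (row_mx (const_mx x : 'rV[R]_1) y) ord0 (ord0 : 'I_(1+n)) = x.
    rewrite (_ : (ord0 : 'I_(1 + n)) = lshift n ord0); last exact: val_inj.
    by rewrite row_mxEl mxE.
  have xS (y : 'rV[R]_n) i :
      (row_mx (const_mx x : 'rV[R]_1) y) ord0 (lift ord0 i : 'I_(1+n)) = y ord0 i.
    rewrite (_ : (lift ord0 i : 'I_(1 + n)) = rshift 1 i); last exact: val_inj.
    by rewrite row_mxEr.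
  rewrite indicE; case: (boolP (a ord0 ord0 <= x <= b ord0 ord0)) => xab.
    rewrite mem_set ?mule1 /=; last by rewrite in_itv.
    rewrite (eq_bigr (fun i => (\row_j b ord0 (lift ord0 j)) ord0 i
      - (\row_j a ord0 (lift ord0 j)) ord0 i)) => [|i _]; last by rewrite !mxE.
    rewrite -IH => [|i]; last by rewrite !mxE.
    congr volume; apply/seteqP; split=> y /= H i.
      by have := H (lift ord0 i); rewrite xS !mxE.
    have [->|[j ->]] : i = ord0 \/ exists j, i = lift ord0 j.
      by case: (unliftP (ord0 : 'I_(1 + n)) i) => [j ->|->]; [right; exists j|left].
    - by rewrite x0.
    - by have := H j; rewrite xS !mxE.
  rewrite memNset /=; last by rewrite in_itv /=; exact/negP.
  rewrite mule0; have -> : [set y : 'rV[R]_n | forall i : 'I_(1 + n),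
      a ord0 i <= (row_mx (const_mx x : 'rV[R]_1) y) ord0 i <= b ord0 i] = set0.
    by apply/seteqP; split=> y //= /(_ ord0); rewrite x0 (negbTE xab).
  elim: n {IH a b ab x0 xS xab} => [|m IH] /=; first by rewrite indicE memNset.
  by apply: integral0_eq => z _; exact: IH.
under eq_integral do rewrite E.
rewrite ge0_integralZl//=; last first.
- by rewrite lee_fin; apply: prodr_ge0 => i _; rewrite subr_ge0.
- apply/measurable_EFinP; exact: measurable_indic.
rewrite integral_indic// setIT /= lebesgue_measure_itv /= big_ord_recl EFinM muleC.
congr (_ * _)%E; rewrite lte_fin; case: ltP => // ba.
by congr EFin; apply/esym/eqP; rewrite subr_eq0 eq_le ba ab.
Qed.

(* Main.v *)
(* Lower bound. Let H = h^n and let S3 be the rest of the cube. By induction on n,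
   vol S1 (H - vol S1) <= 2 H sqrt(n) vol S3. Slice along the first coordinate, with
   g(x), r(x) the volumes of the slices of S1, S3 and H' = h^(n-1). Any slice of S1
   is disjoint from any slice of S2, so al = sup g satisfies al - g(x) <= r(x).
   Together with the induction hypothesis this gives
     g (H' - g) + (al - g)^2 <= 2 H' sqrt(n) r
   pointwise. The left-hand side is al^2 + (H' - 2 al) g, affine in g, so integrating
   in x only replaces g by its mean m, and al^2 + (H' - 2 al) m >= m (H' - m).

   Upper bound. Split the cube by the number of coordinates in the lower half of
   their range: fewer than n/2, exactly n/2, more than n/2. The middle layer has
   relative volume C(n, n/2) / 2^n = O(n^(-1/2)).

   The volume is a sigma-finite measure because (x, y) |-> row_mx x y is measurable
   from the product of the Borel sigma-algebras: an open set is the union of the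
   rational balls, i.e. boxes, that it contains. *)
From HB Require Import structures.
Require Import Defs.
From mathcomp Require Import all_boot all_order all_algebra.
From mathcomp Require Import all_classical all_reals all_analysis.
From mathcomp Require Import measurable_realfun zify ring lra.

Set Implicit Arguments.
Unset Strict Implicit.
Unset Printing Implicit Defensive.

Import Order.TTheory GRing.Theory Num.Theory.
Import numFieldNormedType.Exports.

(** * Binomial sums *)

(** The number of subsets of an n-element set whose size satisfies [T]. By [volume_layer] it is also
    the volume of a layer in units of [(h / 2) ^+ n]. *)
Definition binom_mass (n : nat) (T : pred nat) : nat :=
  (\sum_(k < n.+1) T k * 'C(n, k))%N.

(** Pascal's rule, split by whether the first element is chosen; [volume_layer] meets the same split
    when it slices a layer. *)
Lemma binom_massS (n : nat) (T : pred nat) :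
  binom_mass n.+1 T = (binom_mass n (T \o S) + binom_mass n T)%N.
Proof.
rewrite /binom_mass big_ord_recl.
under eq_bigr do rewrite lift0 binS mulnDr.
rewrite big_split /= addnA addnC; congr addn.
rewrite bin0 -(bin0 n) [RHS](_ : _ = \sum_(k < n.+2) T k * 'C(n, k))%N.
  by rewrite [RHS]big_ord_recl; under [in RHS]eq_bigr do rewrite lift0.
by rewrite [RHS]big_ord_recr /= bin_small// muln0 addn0.
Qed.

Lemma binom_mass_rev (n : nat) (T : pred nat) :
  binom_mass n T = binom_mass n (fun k => T (n - k)%N).
Proof.
rewrite /binom_mass (reindex_inj rev_ord_inj) /=; apply: eq_bigr => k _.
by rewrite subSS bin_sub// -ltnS.
Qed.

Lemma binom_mass1 (n m : nat) : (m <= n)%N -> binom_mass n (pred1 m) = 'C(n, m).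
Proof.
move=> mn; rewrite /binom_mass (bigD1 (inord m : 'I_n.+1)) //= inordK// eqxx mul1n.
rewrite big1 ?addn0// => i im; case: eqP => // E.
by rewrite -E inord_val eqxx in im.
Qed.

Lemma binom_mass_split (n m : nat) : (m <= n)%N ->
  (binom_mass n (fun k => k < m) + 'C(n, m) + binom_mass n (fun k => m < k)
   = 2 ^ n)%N.
Proof.
move=> mn; rewrite -(binom_mass1 mn).
rewrite /binom_mass -!big_split (expnDn 1 1 n); apply: eq_bigr => k _ /=.
by rewrite !exp1n !muln1 -!mulnDl; case: ltngtP => _; rewrite mul1n.
Qed.

Lemma binom_mass_ltS (n m : nat) : (m <= n)%N ->
  binom_mass n (fun k => k < m.+1)%N =
  (binom_mass n (fun k => k < m) + 'C(n, m))%N.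
Proof.
move=> mn; apply/eqP; rewrite -(eqn_add2r (binom_mass n (fun k => m < k)%N)).
rewrite binom_mass_split// (expnDn 1 1 n) -big_split; apply/eqP.
apply: eq_bigr => k _ /=.
by rewrite !exp1n !muln1 -!mulnDl ltnS; case: ltngtP => _; rewrite mul1n.
Qed.

(** Absorption applied twice, with the symmetry C(2m+1, m) = C(2m+1, m+1) in between. *)
Lemma central_binS (m : nat) :
  (m.+1 * 'C(m.+1.*2, m.+1) = 2 * (m.*2.+1 * 'C(m.*2, m)))%N.
Proof.
have -> : (m.+1.*2 = m.*2.+2)%N by lia.
rewrite -mul_bin_diag.
have -> : 'C(m.*2.+1, m) = 'C(m.*2.+1, m.+1).
  by rewrite -bin_sub; [congr binomial; lia|lia].
have := mul_bin_diag m.*2.+1 m; rewrite -pred_Sn; nia.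
Qed.

(** The factor 3m + 1 lets the induction close: by [central_binS] the step reduces to (2m+1)^2
    (3m+4) <= 4 (m+1)^2 (3m+1), whose two sides differ by m. *)
Lemma central_bin_bound (m : nat) : ('C(m.*2, m) ^ 2 * (3 * m + 1) <= 16 ^ m)%N.
Proof.
elim: m => [|m IH] //; have E := central_binS m.
set D := 'C(m.*2, m) in IH E; set D' := 'C(m.+1.*2, m.+1) in E *.
clearbody D D'.
rewrite -(leq_pmul2l (_ : 0 < m.+1 ^ 2 * (3 * m + 1))%N); last first.
  by rewrite muln_gt0 expn_gt0 addn1.
rewrite [leqLHS](_ : _ = (m.+1 * D') ^ 2 * (3 * m.+1 + 1) * (3 * m + 1))%N;
  last by rewrite -!mulnn; lia.
rewrite E (expnS 16) [leqLHS](_ : _ = (4 * m.*2.+1 ^ 2 * (3 * m.+1 + 1)) *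
  (D ^ 2 * (3 * m + 1)))%N; last by rewrite -mul2n; ring.
rewrite [leqRHS](_ : _ = (16 * m.+1 ^ 2 * (3 * m + 1)) * 16 ^ m)%N; last by ring.
by apply: leq_mul => //; nia.
Qed.

(** Reversing k turns the upper tail into the indices below n - m. It equals the lower tail for even
    n and gains the level m for odd n, so 2^n is expressed by M and p = C(n, m) alone and
    [central_bin_bound] compares the two. *)
Lemma half_bin_bound (n : nat) : (2 <= n)%N ->
  let M := binom_mass n (fun k => k < n./2)%N in
  [/\ (M <= binom_mass n (fun k => n./2 < k))%N, (0 < M)%N &
      ('C(n, n./2) ^ 2 * n <= 256 * M ^ 2)%N].
Proof.
move=> n2 M; set m := n./2.
have mn : (m <= n)%N by rewrite leq_half_double; lia.
have := binom_mass_split mn.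
rewrite (binom_mass_rev n (fun k => m < k)%N).
have -> : binom_mass n (fun k => m < n - k)%N = binom_mass n (fun k => k < n - m)%N.
  by apply: eq_bigr => k _; congr (nat_of_bool _ * _)%N; have := ltn_ord k; lia.
rewrite -/M.
have X2 : (16 ^ m = (4 ^ m) ^ 2)%N by rewrite -expnM mulnC expnM.
have X1 : (2 ^ m.*2 = 4 ^ m)%N by rewrite -mul2n expnM.
have X0 : (0 < 4 ^ m)%N by rewrite expn_gt0.
have := odd_double_half n; rewrite -/m; case: (odd n) => /= nE.
  rewrite (_ : (n - m = m.+1)%N); last lia.
  rewrite binom_mass_ltS// -/M; set p := 'C(n, m).
  have := central_bin_bound m.+1; have -> : ('C(m.+1.*2, m.+1) = 2 * p)%N.
    have pE : 'C(n, m.+1) = p by rewrite /p -(bin_sub mn); congr binomial; lia.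
    by rewrite (_ : m.+1.*2 = n.+1); [rewrite binS pE mul2n addnn|lia].
  rewrite (expnS 16) X2 (_ : 2 ^ n = 2 * 4 ^ m)%N; last by rewrite -nE expnS X1.
  move=> pX MX.
  have XE : (4 ^ m = M + p)%N by lia.
  move: X0 pX; rewrite XE => X0 pX.
  (* Here m >= 1, so 3(m+1) + 1 >= 7. The crude [p <= 7 * M] then gives M + p <= 8M, whence 256 = 4
     * 8^2. *)
  have p7 : (7 * p ^ 2 <= 4 * (M + p) ^ 2)%N by nia.
  have M8 : (p <= 7 * M)%N by nia.
  by split; nia.
rewrite (_ : (n - m = m)%N) -/M; last lia.
have := central_bin_bound m; rewrite X2 (_ : m.*2 = n); last lia.
rewrite (_ : 2 ^ n = 4 ^ m)%N; last by rewrite -nE X1.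
set p := 'C(n, m) => pX XE.
move: X0 pX; rewrite -XE => X0 pX.
have p4 : (4 * p ^ 2 <= (M + p + M) ^ 2)%N by nia.
have M2 : (p <= 2 * M)%N by nia.
by split; nia.
Qed.

Local Open Scope classical_set_scope.
Local Open Scope ring_scope.

(** * The volume as a measure on Borel sets *)

Notation borelRV R n := (g_sigma_algebraType (@open 'rV[R]_n)).

Definition slice (R : realType) (n : nat) (A : set 'rV[R]_n.+1) (x : R)
  : set 'rV[R]_n := [set y | A (row_mx (const_mx x : 'rV[R]_1) y)].

Lemma volumeS (R : realType) (n : nat) (A : set 'rV[R]_n.+1) :
  volume A = (\int[@lebesgue_measure R]_x volume (slice A x))%E.
Proof. by []. Qed.

Lemma row_mx_ord0 (R : realType) (n : nat) (x : R) (y : 'rV[R]_n) :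
  (row_mx (const_mx x : 'rV[R]_1) y : 'rV[R]_n.+1) ord0 ord0 = x.
Proof.
rewrite (_ : (ord0 : 'I_(1 + n)) = lshift n ord0); last exact: val_inj.
by apply: etrans (row_mxEl _ _ _ _) _; rewrite mxE.
Qed.

Lemma row_mx_lift (R : realType) (n : nat) (x : R) (y : 'rV[R]_n) (i : 'I_n) :
  (row_mx (const_mx x : 'rV[R]_1) y : 'rV[R]_n.+1) ord0 (lift ord0 i) = y ord0 i.
Proof.
rewrite (_ : (lift ord0 i : 'I_(1 + n)) = rshift 1 i); last exact: val_inj.
exact: row_mxEr.
Qed.

Lemma forall_ordS (n : nat) (P : 'I_n.+1 -> Prop) :
  (forall i, P i) <-> P ord0 /\ forall i, P (lift ord0 i).
Proof.
split=> [H|[H0 H] i]; first by split.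
by case: (unliftP ord0 i) => [j ->|->].
Qed.

Lemma open_bigcup_rat_ball (R : realType) (n : nat) (U : set 'rV[R]_n) :
  open U ->
  U = \bigcup_(p in [set p : 'rV[rat]_n * nat |
                 ball (map_mx ratr p.1 : 'rV[R]_n) p.2.+1%:R^-1 `<=` U])
        ball (map_mx ratr p.1 : 'rV[R]_n) p.2.+1%:R^-1.
Proof.
move=> oU; apply/seteqP; split=> [u Uu|u [p /= sub]]; last exact: sub.
have := open_nbhs_nbhs (conj oU Uu) => /nbhs_ballP[e /= e0 eU].
(* A radius below e / 2 keeps the whole ball around a rational centre near u inside the e-ball of
   u. *)
have [k ke] : exists k : nat, k.+1%:R^-1 < e / 2.
  have e2 : 0 < e / 2 by rewrite divr_gt0.
  exists (Num.truncn (e / 2)^-1).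
  by rewrite invf_plt ?posrE// truncnS_gt.
have Q i : exists q : rat, ball (u ord0 i) k.+1%:R^-1 (ratr q).
  have [||z [/= zB [q _ qz]]] := @dense_rat R (ball (u ord0 i) k.+1%:R^-1).
  - by exists (u ord0 i); exact: ballxx.
  - exact: ball_open.
  by exists q; rewrite qz.
pose q : 'rV[rat]_n := \row_i sval (cid (Q i)).
have qu : ball (map_mx ratr q : 'rV[R]_n) k.+1%:R^-1 u.
  split=> [|i j]; first by rewrite invr_gt0.
  by rewrite !mxE (ord1 i); apply: ball_sym; exact: svalP (cid (Q j)).
exists (q, k) => //= v qv; apply: eU.
apply: (@le_ball _ _ _ (k.+1%:R^-1 + k.+1%:R^-1));
  first by rewrite [leRHS]splitr lerD// ltW.
by apply: ball_triangle qv; exact: ball_sym.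
Qed.

Lemma measurable_row_mx (R : realType) (n : nat) :
  measurable_fun [set: R * borelRV R n]
    (fun p => row_mx (const_mx p.1 : 'rV[R]_1) p.2 : borelRV R n.+1).
Proof.
refine (@measurability _ _ (R * borelRV R n)%type (borelRV R n.+1) setT _
  (@open 'rV[R]_n.+1) erefl _) => _ [U oU <-].
rewrite setTI (open_bigcup_rat_ball oU) preimage_bigcup bigcup_mkcond.
apply: countable_bigcupT_measurable; first exact: countableP.
move=> [q k]; case: ifPn => // _ /=.
set e := _^-1.
(* Balls of rows are taken coordinatewise, so the preimage of a ball is an interval times a ball of
   the tails. *)
rewrite [X in measurable X](_ : _ = ball (ratr (q ord0 ord0) : R) e `*`
  (ball (\row_i ratr (q ord0 (lift ord0 i)) : 'rV[R]_n) e)).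
  apply: measurableX.
  - by apply: open_measurable; exact: ball_open.
  - by apply: sub_sigma_algebra; exact: ball_open.
apply/seteqP; split=> -[x y] /=.
  move=> [e0 H]; split.
    by have := H ord0 ord0; rewrite row_mx_ord0 mxE.
  split=> // i j; have := H ord0 (lift ord0 j).
  by rewrite row_mx_lift !mxE (ord1 i).
move=> [H0 [e0 H]]; split=> // i; rewrite (ord1 i).
apply/forall_ordS; split=> [|j]; first by rewrite row_mx_ord0 mxE.
by have := H ord0 j; rewrite row_mx_lift !mxE.
Qed.

Lemma volume_ge0 (R : realType) (n : nat) (A : set 'rV[R]_n) : (0 <= volume A)%E.
Proof.
by elim: n A => [|n IH] A /=; [rewrite lee_fin | exact: integral_ge0].
Qed.

Lemma volume_set0 (R : realType) (n : nat) : volume (set0 : set 'rV[R]_n) = 0%E.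
Proof.
elim: n => [|n IH] /=; first by rewrite indic0.
by rewrite integral0_eq.
Qed.

Lemma open_coord (R : realType) (n : nat) (i : 'I_n) (B : set R) :
  open B -> open [set x : 'rV[R]_n | B (x ord0 i)].
Proof.
by move=> oB; apply: (open_comp _ oB) => x _; exact: coord_continuous.
Qed.

Lemma measurable_box (R : realType) (n : nat) (a b : 'rV[R]_n) :
  measurable ([set x | forall i, a ord0 i <= x ord0 i <= b ord0 i] : set (borelRV R n)).
Proof.
rewrite [X in measurable X](_ : _ = \bigcap_(i in [set: 'I_n])
  ((~` [set x : 'rV[R]_n | x ord0 i < a ord0 i]) `&`
   (~` [set x : 'rV[R]_n | b ord0 i < x ord0 i]))); last first.
  apply/seteqP; split=> x /= H i.
    by move=> _; have /andP[] := H i; rewrite /= !leNgt => /negP ? /negP.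
  by have [/= /negP + /negP] := H i I; rewrite -!leNgt => -> ->.
apply: fin_bigcap_measurable => // i _; apply: measurableI; apply: measurableC;
  apply: sub_sigma_algebra.
- exact: (open_coord (B := [set y | y < a ord0 i]) (@open_lt R _)).
- exact: (open_coord (B := [set y | b ord0 i < y]) (@open_gt R _)).
Qed.

Lemma volume_sigma_finite (R : realType) (n : nat) :
  sigma_finite setT (@volume R n : set (borelRV R n) -> \bar R).
Proof.
pose B k := [set x : 'rV[R]_n | forall i,
  (const_mx (- k%:R) : 'rV[R]_n) ord0 i <= x ord0 i
    <= (const_mx k%:R : 'rV[R]_n) ord0 i].
exists B => [|k]; last first.
  split; first exact: measurable_box.
  rewrite /B volume_box ?ltry// => i; rewrite !mxE.
  by rewrite (@le_trans _ _ 0) ?oppr_le0.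
apply/esym; rewrite -subTset => x _.
exists (Num.truncn `|x|).+1 => //= i; rewrite !mxE -ler_norml.
rewrite (le_trans _ (ltW (truncnS_gt _)))//.
by rewrite [leRHS]/Num.norm /= mx_normrE; apply/bigmax_geP; right; exists (ord0, i).
Qed.

Lemma xsection_row_mx (R : realType) (n : nat) (A : set 'rV[R]_n.+1) (x : R) :
  xsection ((fun p => row_mx (const_mx p.1 : 'rV[R]_1) p.2) @^-1` A) x = slice A x.
Proof. by apply/seteqP; split=> y; rewrite /xsection /= inE. Qed.

(** In dimension n + 1 the volume is the product of Lebesgue measure and [mu], transported along the
    measurable map [row_mx], so additivity is inherited from the product measure. *)
Lemma volumeS_semi_sigma_additive (R : realType) (n : nat)
    (mu : {sigma_finite_measure set (borelRV R n) -> \bar R}) :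
  (forall A, mu A = volume A) ->
  semi_sigma_additive (@volume R n.+1 : set (borelRV R n.+1) -> \bar R).
Proof.
move=> muE; pose phi (p : R * borelRV R n) : borelRV R n.+1 :=
  row_mx (const_mx p.1 : 'rV[R]_1) p.2.
have volE A : volume A = (lebesgue_measure \x mu)%E (phi @^-1` A).
  by apply: eq_integral => x _; rewrite /= muE xsection_row_mx.
have mphi A : measurable A -> measurable (phi @^-1` A).
  by move=> mA; rewrite -[X in measurable X]setTI; exact: measurable_row_mx.
move=> F mF tF _; under eq_fun do under eq_bigr do rewrite volE.
rewrite volE preimage_bigcup.
apply: measure_semi_sigma_additive => [i||]; first exact: mphi.
- apply/trivIsetP => i j _ _ ij; rewrite -preimage_setI.
  by move/trivIsetP : tF => ->//; rewrite preimage_set0.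
- by apply: bigcup_measurable => i _; exact: mphi.
Qed.

Lemma volume_semi_sigma_additive (R : realType) (n : nat) :
  semi_sigma_additive (@volume R n : set (borelRV R n) -> \bar R).
Proof.
elim: n => [|n IH].
  exact: (@measure_semi_sigma_additive _ _ _ (dirac (0 : borelRV R 0))).
(* The product measure needs a sigma-finite measure in dimension n, so the induction hypothesis is
   packed into one. *)
pose m := isMeasure.Build _ _ _ (@volume R n : set (borelRV R n) -> \bar R)
  (volume_set0 R n) (@volume_ge0 R n) IH.
pose mu : {measure set (borelRV R n) -> \bar R} := HB.pack (@volume R n) m.
pose s := Measure_isSigmaFinite.Build _ _ _ mu (volume_sigma_finite R n).
pose nu : {sigma_finite_measure set (borelRV R n) -> \bar R} :=
  HB.pack (mu : set _ -> _) m s.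
exact: (@volumeS_semi_sigma_additive R n nu).
Qed.

HB.instance Definition _ (R : realType) (n : nat) :=
  isMeasure.Build _ _ _ (@volume R n : set (borelRV R n) -> \bar R)
    (volume_set0 R n) (@volume_ge0 R n) (@volume_semi_sigma_additive R n).

HB.instance Definition _ (R : realType) (n : nat) :=
  Measure_isSigmaFinite.Build _ _ _ (@volume R n : set (borelRV R n) -> \bar R)
    (volume_sigma_finite R n).

Lemma measurable_slice (R : realType) (n : nat) (A : set (borelRV R n.+1)) (x : R) :
  measurable A -> measurable (slice A x : set (borelRV R n)).
Proof.
move=> mA; rewrite -xsection_row_mx; apply: measurable_xsection.
rewrite -[X in measurable X]setTI.
exact: (@measurable_row_mx R n measurableT _ mA).
Qed.

Lemma measurable_fun_slice (R : realType) (n : nat) (A : set (borelRV R n.+1))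
    (D : set R) :
  measurable A -> measurable_fun D (fun x => volume (slice A x)).
Proof.
move=> mA; apply: (@measurable_funS _ _ _ _ setT) => //.
under eq_fun do rewrite -xsection_row_mx.
apply: (@measurable_fun_xsection _ _ R (borelRV R n) R (@volume R n)).
rewrite -[X in measurable X]setTI.
exact: (@measurable_row_mx R n measurableT _ mA).
Qed.

(** * Cubes, and axis-disjoint sets under slicing *)

Lemma measurable_cube (R : realType) (n : nat) (a : 'rV[R]_n) (h : R) :
  measurable (cube a h : set (borelRV R n)).
Proof.
rewrite (_ : cube a h = [set x | forall i,
  a ord0 i <= x ord0 i <= (a + const_mx h : 'rV[R]_n) ord0 i]).
  exact: measurable_box.
by apply/seteqP; split=> x /= H i; have := H i; rewrite !mxE.
Qed.

Lemma volume_cube (R : realType) (n : nat) (a : 'rV[R]_n) (h : R) :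
  0 <= h -> volume (cube a h) = (h ^+ n)%:E.
Proof.
move=> h0; rewrite (_ : cube a h = [set x | forall i,
  a ord0 i <= x ord0 i <= (a + const_mx h : 'rV[R]_n) ord0 i]); last first.
  by apply/seteqP; split=> x /= H i; have := H i; rewrite !mxE.
rewrite volume_box => [|i]; last by rewrite !mxE lerDl.
rewrite (eq_bigr (fun=> h)) ?prodr_const ?card_ord// => i _.
by rewrite !mxE addrAC subrr add0r.
Qed.

Definition behead_mx (R : realType) (n : nat) (a : 'rV[R]_n.+1) : 'rV[R]_n :=
  \row_i a ord0 (lift ord0 i).

Lemma slice_cube (R : realType) (n : nat) (a : 'rV[R]_n.+1) (h x : R) :
  x \in `[a ord0 ord0, a ord0 ord0 + h] ->
  slice (cube a h) x = cube (behead_mx a) h.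
Proof.
rewrite in_itv /= => ax; apply/seteqP; split=> y.
  by move=> H i; have := H (lift ord0 i); rewrite row_mx_lift mxE.
move=> H; apply/forall_ordS; split=> [|i]; first by rewrite row_mx_ord0.
by have := H i; rewrite row_mx_lift mxE.
Qed.

Lemma volume_sub_cube (R : realType) (n : nat) (a : 'rV[R]_n.+1) (h : R)
    (A : set 'rV[R]_n.+1) : A `<=` cube a h ->
  volume A = (\int[lebesgue_measure]_(x in `[a ord0 ord0, (a ord0 ord0 + h)%R])
                volume (slice A x))%E.
Proof.
move=> Ah; rewrite volumeS [RHS]integral_mkcond; apply: eq_integral => x _.
rewrite patchE; case: ifPn => //; rewrite notin_setE /= in_itv /= => /negP xh.
rewrite (_ : slice A x = set0) ?volume_set0//.
rewrite -subset0 => y /Ah /(_ ord0).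
by rewrite row_mx_ord0 (negbTE xh).
Qed.

Lemma volume_fin_num (R : realType) (n : nat) (a : 'rV[R]_n) (h : R)
    (A : set (borelRV R n)) : 0 <= h -> measurable A -> A `<=` cube a h ->
  volume A \is a fin_num.
Proof.
move=> h0 mA Ah; rewrite ge0_fin_numE ?volume_ge0//.
apply: (@le_lt_trans _ _ (volume (cube a h))); last by rewrite volume_cube ?ltry.
by apply: (le_measure (@volume R n)) => //; rewrite inE//; exact: measurable_cube.
Qed.

Lemma l0_row_mx (R : realType) (n : nat) (x x' : R) (y y' : 'rV[R]_n) :
  l0 (row_mx (const_mx x : 'rV[R]_1) y - row_mx (const_mx x' : 'rV[R]_1) y'
      : 'rV[R]_n.+1) = ((x != x') + l0 (y - y'))%N.
Proof.
rewrite /l0 -!sum1_card big_mkcond big_ord_recl [in RHS]big_mkcond /=; congr (_ + _)%N.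
  have := row_mx_ord0 x y; have := row_mx_ord0 x' y'.
  by rewrite inE !mxE => -> ->; rewrite subr_eq0; case: eqP.
apply: eq_bigr => i _; have := row_mx_lift x y i; have := row_mx_lift x' y' i.
by rewrite !inE !mxE => -> ->.
Qed.

Lemma axis_disjoint_slice (R : realType) (n : nat) (A B : set 'rV[R]_n.+1) (x : R) :
  axis_disjoint A B -> axis_disjoint (slice A x) (slice B x).
Proof. by move=> AB y z Ay Bz; have := AB _ _ Ay Bz; rewrite l0_row_mx eqxx. Qed.

(** Points with a common tail differ in at most the first coordinate, which axis-disjointness
    forbids. *)
Lemma disjoint_slices (R : realType) (n : nat) (A B : set 'rV[R]_n.+1) (x x' : R) :
  axis_disjoint A B -> slice A x `&` slice B x' = set0.
Proof.
move=> AB; rewrite -subset0 => y [Ay By]; have := AB _ _ Ay By.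
by rewrite l0_row_mx subrr /l0 eq_card0 ?addn0 => [|i]; [case: eqP|rewrite inE mxE eqxx].
Qed.

(** * Lower bound *)

(* The hypothesis bounds J = g (H - g) by 2 H sqrt(n) r, and D = al - g is at most
   r; then (J + D^2)^2 <= 4 H^2 (n + 1) r^2 because J <= H^2 / 4 and D <= H. The
   conclusion, J + D^2 <= 2 H sqrt(n + 1) r, is rearranged to be affine in g and r. *)
Lemma profile_step (R : realType) (n : nat) (H g r al : R) :
  0 <= g <= H -> 0 <= r -> g <= al <= g + r -> al <= H ->
  g * (H - g) <= 2 * H * Num.sqrt n%:R * r ->
  al ^+ 2 + H * g <= 2 * H * Num.sqrt n.+1%:R * r + 2 * al * g.
Proof.
move=> /andP[g0 gH] r0 /andP[gal alr] alH J.
have H0 : 0 <= H by lra.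
suff : g * (H - g) + (al - g) ^+ 2 <= 2 * H * Num.sqrt n.+1%:R * r by lra.
set J' := g * (H - g) in J *; set D := al - g.
have J0 : 0 <= J' by rewrite mulr_ge0// subr_ge0.
have J4 : 4 * J' <= H ^+ 2 by have := sqr_ge0 (H - 2 * g); rewrite /J'; lra.
have D0 : 0 <= D by rewrite subr_ge0.
have DH : D <= H by rewrite /D; lra.
have Dr : D <= r by rewrite /D; lra.
have DH2 : D ^+ 2 <= H ^+ 2 by rewrite ler_sqr.
have Dr2 : D ^+ 2 <= r ^+ 2 by rewrite ler_sqr.
rewrite -ler_sqr ?nnegrE; last 2 first.
- by rewrite addr_ge0 ?sqr_ge0.
- by rewrite !mulr_ge0 ?sqrtr_ge0.
have J2 : J' ^+ 2 <= 4 * (H * r) ^+ 2 * n%:R.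
  rewrite -[n%:R](@sqr_sqrtr R) ?ler0n//.
  rewrite (_ : _ * _ = (2 * H * Num.sqrt n%:R * r) ^+ 2); last by ring.
  by rewrite ler_sqr ?nnegrE// !mulr_ge0 ?sqrtr_ge0.
have -> : (2 * H * Num.sqrt n.+1%:R * r) ^+ 2 = 4 * (H * r) ^+ 2 * (n%:R + 1).
  by rewrite natr1 -[in RHS](@sqr_sqrtr R n.+1%:R) ?ler0n//; ring.
(* In the expanded square, J'^2 uses the n part of the right-hand side; 2 J' D^2 + D^4 is at most
   (3/2) (H r)^2, below the remaining 4 (H r)^2. *)
have JD : 4 * J' * D ^+ 2 <= H ^+ 2 * r ^+ 2 by apply: ler_pM; rewrite ?sqr_ge0//; lra.
have DD : D ^+ 2 * D ^+ 2 <= H ^+ 2 * r ^+ 2 by rewrite ler_pM ?sqr_ge0.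
have Hr : 0 <= H ^+ 2 * r ^+ 2 by rewrite mulr_ge0 ?sqr_ge0.
lra.
Qed.

(** The product form, unlike a quotient, stays meaningful for slices of volume zero, so the
    induction can use it on every slice. *)
Lemma cube_profile (R : realType) (n : nat) (a : 'rV[R]_n) (h : R)
    (S1 S2 : set 'rV[R]_n) :
  0 < h -> borel S1 -> borel S2 -> S1 `<=` cube a h -> S2 `<=` cube a h ->
  axis_disjoint S1 S2 ->
  fine (volume S1) * (h ^+ n - fine (volume S1)) <=
  2 * h ^+ n * Num.sqrt n%:R * fine (volume (cube a h `\` (S1 `|` S2))).
Proof.
move=> h0; elim: n a S1 S2 => [|n IH] a S1 S2 mS1 mS2 S1h S2h S12.
  (* In dimension 0 the volume v of S1 is 0 or 1, so v (1 - v) = 0. *)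
  by rewrite sqrtr0 mulr0 mul0r expr0 /= indicE; case: (_ \in _);
    rewrite ?subrr ?mulr0 ?mul0r.
set S3 := cube a h `\` _.
have mS3 : measurable (S3 : set (borelRV R n.+1)).
  by apply: measurableD; [exact: measurable_cube|exact: measurableU].
have S3h : S3 `<=` cube a h by move=> x [].
have h0' := ltW h0.
set I := `[a ord0 ord0, a ord0 ord0 + h]%classic.
have slh x : I x -> forall A, A `<=` cube a h -> slice A x `<=` cube (behead_mx a) h.
  by move=> Ix A Ah; rewrite -(slice_cube Ix) => y; exact: Ah.
have slfin x : I x -> forall A : set (borelRV R n.+1), measurable A -> A `<=` cube a h ->
    (fine (volume (slice A x)))%:E = volume (slice A x).
  move=> Ix A mA Ah; rewrite fineK//.
  exact: volume_fin_num h0' (measurable_slice x mA) (slh _ Ix _ Ah).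
pose H := h ^+ n.
pose g x := fine (volume (slice S1 x)); pose r x := fine (volume (slice S3 x)).
have g0 x : 0 <= g x by rewrite fine_ge0 ?volume_ge0.
have r0 x : 0 <= r x by rewrite fine_ge0 ?volume_ge0.
have gH x : I x -> g x <= H.
  move=> Ix; rewrite -lee_fin slfin// -(volume_cube (behead_mx a) h0').
  apply: (le_measure (@volume R n)); rewrite ?inE; [exact: measurable_slice|
    exact: measurable_cube|exact: slh].
(* The slice of S1 at x' misses the slice of S2 at x, so within the cube it is covered by the slices
   of S1 and S3 at x. Taking the supremum over x' gives [alr]. *)
have ggr x x' : I x -> I x' -> g x' <= g x + r x.
  move=> Ix Ix'; rewrite -lee_fin EFinD !slfin//.
  apply: (@le_trans _ _ (volume (slice S1 x `|` slice S3 x))).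
    apply: (le_measure (@volume R n)); rewrite ?inE; [exact: measurable_slice|
      apply: measurableU; exact: measurable_slice|].
    move=> y Sy; have [Sxy|Sxy] := pselect (slice S1 x y); [by left|right].
    split; first by have := slh _ Ix' _ S1h _ Sy; rewrite -(slice_cube Ix).
    move=> [//|S2y]; suff : (slice S1 x' `&` slice S2 x) y by rewrite disjoint_slices.
    by [].
  by apply: (measureU2 (@volume R n)); exact: measurable_slice.
pose al := sup (g @` I).
have Ia : I (a ord0 ord0) by rewrite /I /= in_itv/= lexx lerDl.
have supg : has_sup (g @` I).
  split; first by exists (g (a ord0 ord0)); exists (a ord0 ord0).
  by exists H => _ [x Ix <-]; exact: gH.
have gal x : I x -> g x <= al by move=> Ix; apply: ub_le_sup; [exact: supg.2|exists x].
have alr x : I x -> al <= g x + r x.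
  by move=> Ix; apply: ge_sup; [exact: supg.1|move=> _ [x' Ix' <-]; exact: ggr].
have alH : al <= H by apply: ge_sup; [exact: supg.1|move=> _ [x Ix <-]; exact: gH].
have al0 : 0 <= al by apply: le_trans (gal _ Ia).
set s1 := fine (volume S1); set s3 := fine (volume S3).
have E1 : s1%:E = (\int[lebesgue_measure]_(x in I) volume (slice S1 x))%E.
  by rewrite -volume_sub_cube// fineK// (volume_fin_num h0' mS1 S1h).
have E3 : s3%:E = (\int[lebesgue_measure]_(x in I) volume (slice S3 x))%E.
  by rewrite -volume_sub_cube// fineK// (volume_fin_num h0' mS3 S3h).
have mI : measurable I by exact: measurable_itv.
have leI : lebesgue_measure I = h%:E.
  rewrite /I lebesgue_measure_itv /= lte_fin ltrDl h0 -EFinD.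
  by congr EFin; ring.
set t := Num.sqrt _.
(* This is [profile_step] integrated over [I], of length h; being affine in g and r, it involves
   only their integrals s1 and s3. *)
have main : al ^+ 2 * h + H * s1 <= 2 * H * t * s3 + 2 * al * s1.
  have Ht : 0 <= 2 * H * t by rewrite !mulr_ge0 ?sqrtr_ge0// exprn_ge0.
  have H0 : 0 <= H by rewrite exprn_ge0.
  rewrite -lee_fin !EFinD [(al ^+ 2 * h)%:E]EFinM [(H * s1)%:E]EFinM.
  rewrite [(2 * H * t * s3)%:E]EFinM [(2 * al * s1)%:E]EFinM E1 E3 -leI.
  have mZ (k : R) (A : set (borelRV R n.+1)) : measurable A ->
      measurable_fun I (fun x => k%:E * volume (slice A x))%E.
    move=> mA; apply: emeasurable_funM; first exact: measurable_cst.
    exact: measurable_fun_slice.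
  have v0 A x : (0 <= volume (slice A x))%E by exact: volume_ge0.
  rewrite -integral_cst// -!ge0_integralZl// ?lee_fin ?mulr_ge0//;
    try exact: measurable_fun_slice.
  rewrite -!ge0_integralD//; try (by move=> x _; rewrite mule_ge0 ?lee_fin ?Ht ?mulr_ge0);
    try exact: mZ; last first.
    by move=> x _; rewrite /= lee_fin sqr_ge0.
  apply: ge0_le_integral => //.
  - by move=> x _; rewrite adde_ge0 ?mule_ge0 ?lee_fin ?sqr_ge0.
  - by apply: emeasurable_funD; [exact: measurable_cst|exact: mZ].
  - by apply: emeasurable_funD; exact: mZ.
  move=> x Ix /=; have := slfin x Ix _ mS1 S1h; have := slfin x Ix _ mS3 S3h.
  rewrite -/(g x) -/(r x) => <- <-; rewrite -!EFinM -!EFinD lee_fin.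
  apply: profile_step; [by rewrite g0 gH|exact: r0|by rewrite gal ?alr|exact: alH|].
  have gE : slice S3 x = cube (behead_mx a) h `\` (slice S1 x `|` slice S2 x).
    by rewrite -(slice_cube Ix).
  rewrite /g /r gE; apply: IH.
  - exact: measurable_slice.
  - exact: measurable_slice.
  - exact: slh.
  - exact: slh.
  - exact: axis_disjoint_slice.
rewrite exprS -/H.
(* After multiplication by h, the bound 2 al h s1 - s1^2 <= (al h)^2 cancels every term in al. *)
by have := ler_wpM2r h0' main; have := sqr_ge0 (al * h - s1); lra.
Qed.

Lemma powR_N12 (R : realType) (n : nat) : n%:R `^ (- 2^-1) = (Num.sqrt (n%:R : R))^-1.
Proof. by rewrite powRN powR12_sqrt ?ler0n. Qed.

(** If m is the smaller of the two volumes, [cube_profile] and [mH] give m H / 2 <= 2 H sqrt(n) s3,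
    hence the constant 1/4. *)
Lemma psi_cube_ge (R : realType) (n : nat) (a : 'rV[R]_n) (h : R) :
  (0 < n)%N -> 0 < h ->
  ((4^-1 * n%:R `^ (- 2^-1))%:E <= psi (cube a h))%E.
Proof.
move=> n0 h0; have h0' := ltW h0; rewrite powR_N12.
apply: le_ereal_inf_tmp => _ [S1 [S2 [[mS1 mS2] [S1h S2h] S12 + ->]]].
have mK := measurable_cube a h.
have mS3 : measurable (cube a h `\` (S1 `|` S2) : set (borelRV R n)).
  by apply: measurableD => //; exact: measurableU.
have := cube_profile h0 mS1 mS2 S1h S2h S12.
have S12h : (volume S1 + volume S2 <= (h ^+ n)%:E)%E.
  rewrite -(volume_cube a h0') -(measureU (@volume R n))//; last first.
    rewrite -subset0 => x [/S12 S1x /S1x].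
    by rewrite subrr /l0 eq_card0// => i; rewrite inE mxE eqxx.
  apply: (le_measure (@volume R n)); rewrite ?inE//; last by rewrite subUset.
  exact: measurableU.
move: S12h; rewrite -(fineK (volume_fin_num h0' mS1 S1h)).
rewrite -(fineK (volume_fin_num h0' mS2 S2h)).
rewrite -[volume (_ `\` _)](fineK (volume_fin_num h0' mS3 (@subDsetl _ _ _))).
rewrite -EFinD !lee_fin -EFin_min lte_fin /=.
move: (fine _) (fine _) (fine _) => s3 s2 s1 s12 prof m0.
rewrite inver gt_eqF// lee_fin ler_pdivlMr// -invfM mulrC.
rewrite ler_pdivrMr ?mulr_gt0 ?sqrtr_gt0 ?ltr0n//.
move: prof; set H := h ^+ n in s12 *; set t := Num.sqrt _ => prof.
have H0 : 0 < H by rewrite exprn_gt0.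
set m := Num.min s1 s2 in m0 *.
have [ms1 ms2] : m <= s1 /\ m <= s2 by rewrite !ge_min !lexx ?orbT.
clearbody m H t.
(* One of s1 and H - s1 is at least H / 2; the other is at least m, because H - s1 >= s2. *)
have mH : m * (H / 2) <= s1 * (H - s1).
  have [s1H|Hs1] := leP s1 (H / 2);
    first by rewrite ler_pM ?divr_ge0 ?(ltW m0) ?(ltW H0)//; lra.
  by rewrite mulrC ler_pM ?divr_ge0 ?(ltW m0) ?(ltW H0)//; lra.
by rewrite -(ler_pM2r H0); lra.
Qed.

(** * Upper bound *)

Definition low_count (R : realType) (n : nat) (a : 'rV[R]_n) (h : R)
  (x : 'rV[R]_n) : nat := (\sum_(i < n) (x ord0 i < a ord0 i + h / 2)%R)%N.

Definition layer (R : realType) (n : nat) (a : 'rV[R]_n) (h : R) (T : pred nat)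
  : set 'rV[R]_n := [set x | cube a h x /\ T (low_count a h x)].

Lemma measurable_layer (R : realType) (n : nat) (a : 'rV[R]_n) (h : R) (T : pred nat) :
  measurable (layer a h T : set (borelRV R n)).
Proof.
apply: measurableI; first exact: measurable_cube.
pose L i := [set x : 'rV[R]_n | x ord0 i < a ord0 i + h / 2].
have mL i : measurable (L i : set (borelRV R n)).
  apply: sub_sigma_algebra.
  exact: (open_coord (B := [set y | y < a ord0 i + h / 2]) (@open_lt R _)).
(* A finite union over the possible sets s of low coordinates. *)
rewrite [X in measurable X](_ : _ = \bigcup_(s in [set s : {set 'I_n} | T #|s|])
  \bigcap_(i in [set: 'I_n]) (if i \in s then L i else ~` L i)); last first.
  apply/seteqP; split=> [x /= Tx|x [s /= Ts H]].
    exists [set i | x ord0 i < a ord0 i + h / 2]%SET => /=.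
      by move: Tx; rewrite /low_count -sum1_card [in X in _ -> X]big_mkcond;
        under [in X in _ -> X]eq_bigr do rewrite inE.
    by move=> i _; rewrite inE; case: ifPn => // /negP.
  suff -> : low_count a h x = #|s| by [].
  rewrite -sum1_card [RHS]big_mkcond; apply: eq_bigr => i _.
  by have := H i I; case: ifPn => _ /=; rewrite /L /=; case: (_ < _).
apply: fin_bigcup_measurable => // s _; apply: fin_bigcap_measurable => // i _.
by case: ifPn => _ //; exact: measurableC.
Qed.

Lemma low_count_row_mx (R : realType) (n : nat) (a : 'rV[R]_n.+1) (h x : R)
    (y : 'rV[R]_n) :
  low_count a h (row_mx (const_mx x : 'rV[R]_1) y : 'rV[R]_n.+1) =
  ((x < a ord0 ord0 + h / 2)%R + low_count (behead_mx a) h y)%N.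
Proof.
rewrite /low_count big_ord_recl row_mx_ord0; congr addn.
by apply: eq_bigr => i _; rewrite row_mx_lift mxE.
Qed.

Lemma slice_layer (R : realType) (n : nat) (a : 'rV[R]_n.+1) (h x : R) (T : pred nat) :
  x \in `[a ord0 ord0, a ord0 ord0 + h] ->
  slice (layer a h T) x =
  layer (behead_mx a) h (if x < a ord0 ord0 + h / 2 then T \o S else T).
Proof.
move=> xh; rewrite /layer -(slice_cube xh); apply/seteqP.
have E y : T (low_count a h (row_mx (const_mx x : 'rV[R]_1) y : 'rV[R]_n.+1)) =
    (if x < a ord0 ord0 + h / 2 then T \o S else T) (low_count (behead_mx a) h y).
  by rewrite low_count_row_mx; case: ifP.
by split=> y [Ky Ty]; split=> //; [exact: etrans (esym (E y)) Ty|exact: etrans (E y) Ty].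
Qed.

(** On each half of the first side the slices are layers of constant volume, for [T \o S] and for
    [T]; the two halves add up by [binom_massS]. *)
Lemma volume_layer (R : realType) (n : nat) (a : 'rV[R]_n) (h : R) (T : pred nat) :
  0 < h -> volume (layer a h T) = ((binom_mass n T)%:R * (h / 2) ^+ n)%:E.
Proof.
move=> h0; elim: n a T => [|n IH] a T.
  rewrite /binom_mass big_ord_recl big_ord0 bin0 muln1 addn0 expr0 mulr1 /=.
  rewrite indicE; congr (_%:R)%:E; congr nat_of_bool; apply/idP/idP.
    by rewrite inE => -[_]; rewrite /low_count big_ord0.
  by move=> T0; rewrite inE; split; [case|rewrite /low_count big_ord0].
set A := layer a h T; set c : R := a ord0 ord0.
have Ah : A `<=` cube a h by move=> x [].
rewrite (volume_sub_cube Ah) -/c.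
(* The midpoint goes to the upper half, matching the strict inequality in [low_count]. *)
have cE : `[c, c + h]%classic = `[c, c + h / 2[%classic `|` `[c + h / 2, c + h]%classic.
  rewrite -itv_bndbnd_setU// bnd_simp; lra.
rewrite cE ge0_integral_setU//=; first last.
- apply/disj_setPS => x [] /=; rewrite !in_itv /= => /andP[_ xc] /andP[cx _].
  by rewrite ltNge cx in xc.
- by apply: measurable_fun_slice; exact: measurable_layer.
rewrite (eq_integral (cst ((binom_mass n (T \o S))%:R * (h / 2) ^+ n)%:E));
  last first.
  move=> x; rewrite inE /= in_itv /= => /andP[cx xc].
  have xI : x \in `[c, c + h] by rewrite in_itv /= cx /=; lra.
  by rewrite (slice_layer _ xI) -/c xc IH.
rewrite [X in (_ + X)%E](eq_integral
  (cst ((binom_mass n T)%:R * (h / 2) ^+ n)%:E)); last first.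
  move=> x; rewrite inE /= in_itv /= => /andP[cx xc].
  have xI : x \in `[c, c + h] by rewrite in_itv /= xc andbT; lra.
  by rewrite (slice_layer _ xI) -/c ltNge cx IH.
rewrite !integral_cst//= !lebesgue_measure_itv /= !lte_fin.
have h2h : h / 2 < h by lra.
rewrite ltrDl divr_gt0// ltrD2l h2h.
rewrite -!EFinB -!EFinM -EFinD binom_massS natrD exprS; congr EFin.
by field.
Qed.

(** Each changed coordinate alters the low count by at most one, and passing from below m to above m
    takes a jump of at least two. *)
Lemma layer_axis_disjoint (R : realType) (n m : nat) (a : 'rV[R]_n) (h : R) :
  axis_disjoint (layer a h (fun k => k < m)%N) (layer a h (fun k => m < k)%N).
Proof.
move=> x y [_ xm] [_ my].
suff : (low_count a h y <= low_count a h x + l0 (x - y))%N by lia.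
rewrite /low_count /l0 -sum1_card [X in (_ + X)%N]big_mkcond -big_split.
apply: leq_sum => i _; rewrite inE !mxE subr_eq0.
by case: eqVneq => [->|_] /=; [exact: leq_addr|rewrite addn1; case: (_ < _)%R].
Qed.

Lemma psi_cube_le (R : realType) (n : nat) (a : 'rV[R]_n) (h : R) :
  (2 <= n)%N -> 0 < h ->
  (psi (cube a h) <= (16 * n%:R `^ (- 2^-1))%:E)%E.
Proof.
move=> n2 h0; have [M2 M0 pM] := half_bin_bound n2.
set m := n./2 in M2 M0 pM; set M := binom_mass n _ in M2 M0 pM.
have mn : (m <= n)%N by rewrite leq_half_double; lia.
pose S1 := layer a h (fun k => k < m)%N; pose S2 := layer a h (fun k => m < k)%N.
have u0 : 0 < (h / 2) ^+ n by rewrite exprn_gt0// divr_gt0.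
have v3 : volume (cube a h `\` (S1 `|` S2)) = ('C(n, m)%:R * (h / 2) ^+ n)%:E.
  rewrite (_ : _ `\` _ = layer a h (pred1 m)).
    by rewrite volume_layer// binom_mass1.
  apply/seteqP; split=> x.
    move=> [Kx /= H]; split=> //=; case: ltngtP => // lx; exfalso; apply: H.
      by left.
    by right.
  move=> [Kx /= /eqP E]; split=> // -[[_]|[_]] /=; by rewrite E ltnn.
(* [M2] makes S1 the smaller set; for odd n, [n./2] is the lower of the two central levels. *)
have min12 : Order.min (volume S1) (volume S2) = (M%:R * (h / 2) ^+ n)%:E.
  by rewrite !volume_layer// min_l// lee_fin ler_pM2r// ler_nat.
have Mu : 0 < M%:R * (h / 2) ^+ n by rewrite mulr_gt0 ?ltr0n.
apply: ge_ereal_inf; exists (volume (cube a h `\` (S1 `|` S2)) /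
  Order.min (volume S1) (volume S2))%E.
  exists S1, S2; split=> //.
  - by split; exact: measurable_layer.
  - by split=> x [].
  - exact: layer_axis_disjoint.
  - by rewrite min12 lte_fin.
rewrite min12 v3 inver gt_eqF// lee_fin -mulf_div divff ?mulr1 ?gt_eqF// powR_N12.
have t0 : 0 < Num.sqrt (n%:R : R) by rewrite sqrtr_gt0 ltr0n; lia.
rewrite ler_pdivrMr ?ltr0n// mulrAC ler_pdivlMr//.
(* Squaring reduces the goal to [pM]; the constant 16 is the square root of 256. *)
rewrite -ler_sqr ?nnegrE ?mulr_ge0// ?sqrtr_ge0// !exprMn sqr_sqrtr//.
by rewrite -!natrX -!natrM ler_nat (leq_trans pM).
Qed.

Theorem theorem1p2 (R : realType) :
  exists c C : R, 0 < c /\ c <= C /\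
    forall (n : nat) (a : 'rV[R]_n) (h : R), (2 <= n)%N -> 0 < h ->
      ((c * n%:R `^ (- 2^-1))%:E <= psi (cube a h))%E /\
      (psi (cube a h) <= (C * n%:R `^ (- 2^-1))%:E)%E.
Proof.
exists 4^-1, 16; split; first by rewrite invr_gt0.
split=> [|n a h n2 h0]; first lra.
by split; [apply: psi_cube_ge => //; exact: ltnW|exact: psi_cube_le].
Qed.
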